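(* Let $G=(V,c)$ be a transient, connected graph. Then $$R^F(x,y) = \frac{1}{c_x \cdot \mathbb{P}_x[\tau_y < \tau_x^+]}$$ holds for all $x,y \in V$ with $x \neq y$ if and only if $G$ is a subgraph of an infinite line.
   Context: A graph $G=(V,c)$ consists of an at most countable vertex set $V$ and a weight function $c: V\times V \to \mathbb{R}_{\ge 0}$ that is symmetric, with $c(x,x)=0$ and $c_x := \sum_{y\in V} c(x,y) < \infty$ for all $x \in V$. Vertices $x,y$ are adjacent if $c(x,y)>0$; connectedness refers to this adjacency relation. $\mathbb{P}_x$ is the law on $V^{\mathbb{N}_0}$ of the random walk $(\omega_k)_{k\ge 0}$ on $G$ started at $x$, i.e. the Markov chain with transition matrix $p(x,y)=c(x,y)/c_x$ and initial distribution $\delta_x$. $G$ is transient (recurrent) if this chain is transient (recurrent). Hitting times: $\tau_x := \inf\{k\ge 0 : \omega_k = x\}$ and $\tau_x^+ := \inf\{k\ge 1: \omega_k = x\}$, with $\inf\emptyset=\infty$. Effective resistance of a finite connected graph $H=(W,c)$: for distinct $x,y \in W$, $R_H(x,y) := f(x)-f(y)$, where $f: W\to\mathbb{R}$ is any function (unique up to an additive constant) with $\sum_{w\in W} c(v,w)(f(v)-f(w)) = \mathbf{1}_{\{v=x\}} - \mathbf{1}_{\{v=y\}}$ for all $v\in W$ (the voltage drop that induces a unit current from $x$ to $y$ when each edge $(v,w)$ is a resistor of resistance $1/c(v,w)$). Free effective resistance of an infinite connected graph $G=(V,c)$: let $(V_n)_{n\in\mathbb{N}}$ be any sequence of finite subsets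 of $V$ with $V_n\subseteq V_{n+1}$, $\bigcup_n V_n = V$, such that each induced subgraph $G_n := (V_n, c\restriction_{V_n\times V_n})$ is connected. Then $R^F(x,y) := \lim_{n\to\infty} R_{G_n}(x,y)$ (taken over $n$ with $x,y\in V_n$; the limit exists and does not depend on the chosen sequence). $G$ is a subgraph of an infinite line if there is an injective map $\varphi: V\to\mathbb{Z}$ such that $c(x,y)>0$ implies $|\varphi(x)-\varphi(y)|=1$ (weights arbitrary). *)

(* Defs.v *)
From HB Require Import structures.
From mathcomp Require Import all_boot all_order all_algebra finmap.
From mathcomp Require Import all_classical all_reals all_analysis.

Set Implicit Arguments.
Unset Strict Implicit.
Unset Printing Implicit Defensive.

Import Order.TTheory GRing.Theory Num.Theory.
Import numFieldNormedType.Exports.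

Local Open Scope classical_set_scope.
Local Open Scope ring_scope.

(** * Weighted graphs *)

(* [V] is a [pointedType] because the library only puts sigma-algebras on
   pointed types; this excludes nothing but the empty graph. *)
Record graph (R : realType) (V : pointedType) := Graph {
  weight :> V -> V -> R;
  graph_countable : countable [set: V];
  weight_ge0 : forall x y, 0 <= weight x y;
  weight_sym : forall x y, weight x y = weight y x;
  weight_irr : forall x, weight x x = 0;
  weight_summable : forall x, (\esum_(y in [set: V]) (weight x y)%:E < +oo)%E
}.

Section Graphs.
Variables (R : realType) (V : pointedType).
Implicit Types (G : graph R V) (x y : V) (W : {fset V}).

Definition vertex_weight G x : R :=
  fine (\esum_(y in [set: V]) (G x y)%:E).

Definition adjacent G : rel V := fun x y => 0 < G x y.

Definition connected_on G (A : set V) : Prop :=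
  forall x y, A x -> A y ->
    exists p : seq V,
      [/\ path (adjacent G) x p, last x p = y & forall z, z \in p -> A z].

Definition connected_graph G : Prop := connected_on G [set: V].

Definition subgraph_of_line G : Prop :=
  exists phi : V -> int,
    injective phi /\ forall x y, 0 < G x y -> `|phi x - phi y| = 1.

(** * Effective resistance *)

(* [f] is a potential of the unit current flow from [x] to [y] in the subgraph
   of [G] induced by [W]; its values outside [W] play no role. *)
Definition unit_potential G W x y (f : V -> R) : Prop :=
  forall v, v \in W ->
    \sum_(w <- W) G v w * (f v - f w) = (v == x)%:R - (v == y)%:R.

(* Meaningful when [W] induces a connected subgraph containing the distinct
   vertices [x] and [y]: the drop [f x - f y] then exists and is unique. *)
Definition eff_res G W x y : R :=
  xget 0 [set r | exists2 f, unit_potential G W x y f & r = f x - f y].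

Definition exhaustion G (Vn : nat -> {fset V}) : Prop :=
  [/\ forall n, (Vn n `<=` Vn n.+1)%fset,
      forall x, exists n, x \in Vn n
    & forall n, connected_on G [set` Vn n]].

(* The common limit along all exhaustions. The finitely many [n] for which
   [x] or [y] is not yet in [Vn n] do not affect it. *)
Definition free_eff_res G x y : R :=
  xget 0 [set r | forall Vn, exhaustion G Vn ->
                    eff_res G (Vn n) x y @[n --> \oo] --> r].

(** * Random walk *)

(* The product sigma-algebra on [V^nat], [V] being discrete and countable. *)
Definition coordinate_events : set (set (nat -> V)) :=
  [set A | exists k v, A = [set w | w k = v]].

Definition path_space := g_sigma_algebraType coordinate_events.

Definition transition G x y : R := G x y / vertex_weight G x.

Definition random_walk_law G x (P : probability path_space R) : Prop :=
  forall (n : nat) (v : nat -> V),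
    P [set w | forall k, (k <= n)%N -> w k = v k] =
    ((v 0%N == x)%:R * \prod_(k < n) transition G (v k) (v k.+1))%:E.

Definition hitting_time x (w : path_space) : \bar R :=
  ereal_inf [set k%:R%:E | k in [set k : nat | w k = x]].

Definition return_time x (w : path_space) : \bar R :=
  ereal_inf [set k%:R%:E | k in [set k : nat | (1 <= k)%N /\ w k = x]].

(* [P x] is the law of the chain started at [x]. *)
Definition transient (P : V -> probability path_space R) : Prop :=
  forall x, (P x [set w | return_time x w < +oo] < 1)%E.

(* P_x[tau_y < tau_x^+] *)
Definition escape_probability (P : V -> probability path_space R) x y : R :=
  fine (P x [set w | (hitting_time y w < return_time x w)%E]).

End Graphs.

(* Main.v *)
Require Import Defs.
From mathcomp Require Import all_boot all_order all_algebra finmap.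
From mathcomp Require Import all_classical all_reals all_analysis.
From mathcomp Require Import zify lra ring.

Set Implicit Arguments.
Unset Strict Implicit.
Unset Printing Implicit Defensive.

Import Order.TTheory GRing.Theory Num.Theory.
Import numFieldNormedType.Exports.
(* [adjacent] also names a relation between sequences; the graph relation is
   the one meant below. *)
Import Defs.
Local Open Scope classical_set_scope.
Local Open Scope ring_scope.

(** Write [h_xy v] for the probability that the walk from [v] reaches [y]
    before [x].  By the Markov property [h_xy] is harmonic off [x] and [y], and
    [c_x * P_x(tau_y < tau_x^+) = \sum_w c(x,w) h_xy w] is the current that
    [h_xy], read as a voltage, sends out of [x] ([escape_probabilityE]).  Among
    all nonnegative functions that are superharmonic off [x] and [y] and have the
    values 0 at [x] and 1 at [y], [h_xy] is the least one ([two_point_minimal]).  The effective resistance of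
    a finite network is the inverse of the current sent by the unique voltage
    function with these boundary values.  So the two sides of the identity
    compare two voltage functions.

    On a line, the vertices between [x] and [y] form a finite interval and
    nothing behind [x] ever reaches [y] before [x].  If [h_xy] is replaced by 1
    beyond [y], it becomes the voltage function of every finite connected
    subnetwork that contains [x] and [y], and all of these have the same
    effective resistance [1 / (c_x * P_x(tau_y < tau_x^+))]
    ([line_unit_potential]).

    Conversely, suppose the identity holds for all pairs.  Let [H] be the limit,
    along an ultrafilter, of the voltage functions of an exhaustion.  Fatou's
    lemma makes [H] superharmonic off [x] and [y], hence [h_xy <= H]; the identity says that the
    current of [H] out of [x] does not exceed that of [h_xy].  So [H = h_xy] at
    the neighbours of [x], and this equality propagates to all vertices joined
    to [x] by a path avoiding [y] ([voltage_limit]).  Exchanging [x] and [y]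
    replaces [H] by [1 - H], so [h_xy + h_yx = 1] at the vertices joined to each
    of [x], [y] by a path avoiding the other: from there the walk hits [{x, y}]
    almost surely ([recurrent_between]).

    If no vertex of a triple [a], [b], [d] separated the other two, then the
    walk from any one of them would almost surely hit one of the other two, so
    it would keep visiting the triple forever and the graph would be recurrent.
    This is made precise with the superharmonic function
    [v |-> P_v(tau_d < oo)], which has to be 1 at [a], at [b] and at all
    neighbours of [d] ([separation_of_free_eff_res]).  Hence in every triple
    some vertex separates the other two.  This property excludes both branching
    and cycles, and the signed distance from a fixed vertex then embeds the graph
    into the line ([line_of_separation]). *)

(** * Paths inside a set of vertices, and graphs without branching or cycles *)
Section Combinatorics.
Variables (R : realType) (V : pointedType) (G : graph R V).
Implicit Types (x y z u v : V) (A B : set V).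

(** The inductive form of paths gives every propagation argument below (maximum
    principle, intermediate values on a line, spreading of an equality between
    harmonic functions) as a plain induction. *)
Inductive joined A x : V -> Prop :=
| joined_refl : A x -> joined A x x
| joined_step u v : joined A x u -> adjacent G u v -> A v -> joined A x v.

Lemma adjacent_sym u v : adjacent G u v -> adjacent G v u.
Proof. by rewrite /adjacent weight_sym. Qed.

Lemma adjacent_neq u v : adjacent G u v -> u <> v.
Proof. by move=> + uv; rewrite uv /adjacent weight_irr ltxx. Qed.

Lemma joined_start A x y : joined A x y -> A x.
Proof. by elim. Qed.

Lemma joined_end A x y : joined A x y -> A y.
Proof. by case. Qed.

Lemma joined_trans A x y z : joined A x y -> joined A y z -> joined A x z.
Proof.
by move=> xy; elim=> // u v _ xu uv Av; apply: joined_step uv Av.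
Qed.

Lemma joined_sym A x y : joined A x y -> joined A y x.
Proof.
elim=> [Ax|u v xu ux uv Av]; first exact: joined_refl.
apply: joined_trans ux; apply: joined_step (adjacent_sym uv) (joined_end xu).
exact: joined_refl.
Qed.

Lemma sub_joined A B x y : A `<=` B -> joined A x y -> joined B x y.
Proof.
move=> AB; elim=> [/AB|u v _ xu uv /AB Bv]; first exact: joined_refl.
exact: joined_step uv Bv.
Qed.

Lemma connected_on_joined A x y : connected_on G A -> A x -> A y -> joined A x y.
Proof.
move=> cA Ax Ay; have [p [+ <- +]] := cA x y Ax Ay.
elim/last_ind: p {y Ay} => [_ _|p u IH]; first exact: joined_refl.
rewrite rcons_path last_rcons => /andP[xp pu] Ap.
apply: joined_step pu (Ap u _); last by rewrite mem_rcons inE eqxx.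
by apply: IH => // z zp; apply: Ap; rewrite mem_rcons inE zp orbT.
Qed.

Lemma joined_path A x y : joined A x y ->
  exists p, [/\ path (adjacent G) x p, last x p = y & forall z, z \in p -> A z].
Proof.
elim=> [Ax|u v _ [p [xp pu Ap]] uv Av]; first by exists [::].
exists (rcons p v); rewrite rcons_path last_rcons xp pu; split=> // z.
by rewrite mem_rcons inE => /predU1P[->|/Ap].
Qed.

Section Distance.
Variable o : V.
Hypothesis conn : connected_graph G.

Fixpoint walk n v : Prop :=
  if n is m.+1 then exists2 u, walk m u & adjacent G u v else v = o.

Lemma walk_exists v : exists n, `[< walk n v >].
Proof.
have : joined setT o v by apply: connected_on_joined.
elim=> [_|u w _ [n /asboolP nu] uw _]; first by exists 0%N; apply/asboolP.
by exists n.+1; apply/asboolP; exists u.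
Qed.

Definition dist v := ex_minn (walk_exists v).

Lemma dist_le n v : walk n v -> (dist v <= n)%N.
Proof. by rewrite /dist; case: ex_minnP => m _ + /asboolP; apply. Qed.

Lemma walk_dist v : walk (dist v) v.
Proof. by rewrite /dist; case: ex_minnP => m /asboolP. Qed.

Lemma dist_eq0 v : dist v = 0%N <-> v = o.
Proof.
split=> [d0|->]; first by have := walk_dist v; rewrite d0.
by apply/eqP; rewrite -leqn0; exact: dist_le.
Qed.

Lemma dist_adjacent u v : adjacent G u v -> (dist v <= (dist u).+1)%N.
Proof. by move=> uv; apply: dist_le; exists u => //; exact: walk_dist. Qed.

Lemma dist_pred v n : dist v = n.+1 -> exists2 u, adjacent G u v & dist u = n.
Proof.
move=> dv; have := walk_dist v; rewrite dv => -[u nu uv]; exists u => //.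
by apply/eqP; rewrite eqn_leq dist_le //= -ltnS -dv dist_adjacent.
Qed.

(** All vertices of a geodesic but its endpoint are strictly closer to [o]. *)
Lemma geodesic_avoids u v : dist u = dist v -> u <> v -> joined (~` [set u]) o v.
Proof.
move=> duv uv.
suff H n w : dist w = n -> (dist w < dist u)%N \/ w = v -> joined (~` [set u]) o w.
  by apply: (H (dist v)) => //; right.
elim: n w => [|n IH] w dw wuv.
  have wo := (dist_eq0 w).1 dw; rewrite wo.
  by apply: joined_refl => /= ou; case: wuv => [|wv];
    [rewrite -ou -wo ltnn|apply: uv; rewrite -wv wo].
have [z zw dz] := dist_pred dw.
have wu : w <> u by case: wuv => [+ wu|->]; [rewrite wu ltnn|exact: nesym].
apply: joined_step (zw) (wu); apply: IH => //; left.
by rewrite dz -ltnS -dw; case: wuv => [/ltnW//|->]; rewrite duv ltnS.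
Qed.

End Distance.

(** The embedding is the distance to [o], counted negatively on the vertices that
    [o] separates from a chosen neighbour [e].  Two vertices on the same side and
    at the same distance would form, with [o] or with [e], a triple none of which
    separates the other two. *)
Lemma line_of_separation : connected_graph G ->
  (forall a b d, a <> b -> b <> d -> a <> d ->
     joined (~` [set a]) b d -> joined (~` [set b]) a d ->
     joined (~` [set d]) a b -> False) ->
  subgraph_of_line G.
Proof.
move=> conn sep; have o : V := point.
have [[e oe]|noe] := pselect (exists e, adjacent G o e); last first.
  have allo v : v = o.
    have : joined setT o v by apply: connected_on_joined.
    by elim=> // u w _ -> ow; case: noe; exists w.
  exists (fun=> 0); split=> [u v _|u v]; first by rewrite (allo u) (allo v).
  by rewrite (allo u) (allo v) weight_irr ltxx.
pose d := dist o conn.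
have eo : e <> o := nesym (adjacent_neq oe).
pose S := joined (~` [set o]) e.
have oS : ~ S o by move/joined_end; apply.
have SS u v : adjacent G u v -> v <> o -> S u -> S v.
  by move=> uv vo Su; apply: joined_step uv vo.
(* A geodesic to the negative side never meets [e], which is on the positive
   side. *)
have away v : ~ S v -> joined (~` [set e]) o v.
  move dv : (d v) => n; elim: n v dv => [|n IH] v dv Sv.
    by rewrite ((dist_eq0 o conn v).1 dv); apply: joined_refl => /esym.
  have [u uv du] := dist_pred dv.
  have vo : v <> o by move=> /(dist_eq0 o conn); rewrite -/d dv.
  have ve : v <> e by move=> ve; apply: Sv; rewrite ve; apply: joined_refl.
  by apply: joined_step (uv) ve; apply: IH => // /(SS _ _ uv vo).
pose phi v : int := if `[< S v >] then (d v)%:Z else - (d v)%:Z.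
have absphi v : `|phi v|%N = d v by rewrite /phi; case: ifP; lia.
have phi_inj : injective phi.
  move=> u v phiuv; apply: contrapT => uv.
  have duv : d u = d v by rewrite -!absphi phiuv.
  have [ou|ou] := pselect (u = o).
    apply: uv; rewrite ou; apply/esym/(dist_eq0 o conn).
    by rewrite -/d -duv; apply/(dist_eq0 o conn).
  have [ov|ov] := pselect (v = o).
    by apply: ou; apply/(dist_eq0 o conn); rewrite -/d duv; apply/(dist_eq0 o conn).
  have du0 : d u <> 0%N by move/(dist_eq0 o conn).
  have guv : joined (~` [set u]) o v := geodesic_avoids duv uv.
  have gvu : joined (~` [set v]) o u := geodesic_avoids (esym duv) (nesym uv).
  have nuv : ~ joined (~` [set o]) u v.
    by move=> juv; apply: (sep o u v) => //; exact: nesym.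
  move: phiuv; rewrite /phi; case: asboolP => Su; case: asboolP => Sv; try lia.
    by move=> _; apply: nuv; apply: joined_trans (joined_sym Su) Sv.
  move=> _.
  have through w z : w <> o -> w <> e -> joined (~` [set w]) o z ->
      joined (~` [set w]) e z.
    move=> wo we; apply: joined_trans.
    apply: joined_step (adjacent_sym oe) (nesym wo).
    by apply: joined_refl; exact: nesym.
  have noteq w : ~ S w -> w <> e by move=> + we; rewrite we; apply; exact: joined_refl.
  apply: (sep e u v) => //.
  - exact/nesym/noteq.
  - exact/nesym/noteq.
  - exact: joined_trans (joined_sym (away _ Su)) (away _ Sv).
  - by apply: through => //; exact: noteq.
  - by apply: through => //; exact: noteq.
exists phi; split=> // u v uv.
have duv := dist_adjacent o conn uv.
have dvu := dist_adjacent o conn (adjacent_sym uv).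
have d0 w : w = o <-> d w = 0%N by rewrite dist_eq0.
have neq : phi u <> phi v by move/phi_inj; apply: adjacent_neq.
have [uo|uo] := pselect (u = o).
  have vo : v <> o by move=> vo; apply: (adjacent_neq uv); rewrite uo vo.
  have := absphi u; have := absphi v; move: (d0 u).1 (d0 v).2; rewrite -/d in duv dvu *.
  move=> /(_ uo) du0 dv0; have : d v <> 0%N by move/dv0.
  lia.
have [vo|vo] := pselect (v = o).
  have := absphi u; have := absphi v; move: (d0 v).1 (d0 u).2; rewrite -/d in duv dvu *.
  move=> /(_ vo) dv0 du0; have : d u <> 0%N by move/du0.
  lia.
have side : S u <-> S v by split; apply: SS => //; exact: adjacent_sym.
move: neq; rewrite /phi; rewrite -/d in duv dvu.
by case: asboolP => Su; case: asboolP => Sv; try tauto; lia.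
Qed.

End Combinatorics.

(** * Exhaustions and finite networks *)

Section Exhaustions.
Variables (R : realType) (V : pointedType) (G : graph R V).
Implicit Types (x y z u v : V) (A : set V) (W : {fset V}).

Lemma countable_enum : exists (D : set nat) (e : nat -> V), set_bij D setT e.
Proof.
have /countable_injP[f finj] := graph_countable G.
pose e i := xget point [set v | f v = i].
have fK v : e (f v) = v.
  apply: finj; rewrite ?inE//.
  by apply: (@xgetPex _ _ [set u | f u = f v]); exists v.
exists [set f v | v in setT], e; split=> // [i j|v _].
  by rewrite !inE => -[u _ <-] [v _ <-]; rewrite !fK => ->.
by exists (f v).
Qed.

Lemma connected_on_star A o :
  (forall x, A x -> joined G A o x) -> connected_on G A.
Proof.
move=> Ao x y /Ao ox /Ao oy.
exact: joined_path (joined_trans (joined_sym ox) oy).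
Qed.

(** Recording that the finite set is connected to [o] at each of its points makes
    unions of such sets connected again. *)
Lemma finite_connection o x : connected_graph G ->
  exists2 W : {fset V}, x \in W & forall z, z \in W -> joined G [set` W] o z.
Proof.
move=> conn; have : joined G setT o x by apply: connected_on_joined.
elim=> [_|u v _ [W uW oW] uv _].
  exists [fset o]%fset; first by rewrite inE.
  by move=> z; rewrite inE => /eqP->; apply: joined_refl; rewrite /= inE.
have sub : [set` W] `<=` [set` (v |` W)%fset].
  by move=> z /= zW; rewrite !inE zW orbT.
exists (v |` W)%fset; first by rewrite !inE eqxx.
move=> z; rewrite !inE => /predU1P[->|zW]; last exact: sub_joined (oW z zW).
by apply: joined_step (sub_joined sub (oW u uW)) uv _; rewrite /= !inE eqxx.
Qed.

Lemma exhaustion_exists : connected_graph G -> exists Vn, exhaustion G Vn.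
Proof.
move=> conn; have [D [e [_ _ De]]] := countable_enum.
pose o : V := point.
have /choice[F HF] x : exists W : {fset V},
    x \in W /\ forall z, z \in W -> joined G [set` W] o z.
  by have [W] := finite_connection o x conn; exists W.
pose Vn := fix Vn n :=
  if n is m.+1 then (Vn m `|` F (e n))%fset else F (e 0%N).
have FVn n : (F (e n) `<=` Vn n)%fset.
  by case: n => [|n] /=; [exact: fsubset_refl|exact: fsubsetUr].
exists Vn; split=> [n|x|n]; first exact: fsubsetUl.
- by have [i _ <-] := De x I; exists i; apply: (fsubsetP (FVn i)); have [] := HF (e i).
- apply: (@connected_on_star _ o).
  elim: n => [|n IH] x /= xn; first exact: (HF _).2.
  move: xn; rewrite in_fsetU => /orP[/IH|/(HF _).2]; apply: sub_joined.
    by move=> z /= zn; rewrite in_fsetU zn.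
  by move=> z /= zn; rewrite in_fsetU zn orbT.
Qed.

End Exhaustions.

Section FiniteNetworks.
Variables (R : realType) (V : pointedType) (G : graph R V) (W : {fset V}).
Implicit Types (x y z u v : V) (f g : V -> R).

(** Summation by parts: the graph Laplacian is symmetric. *)
Lemma green f g :
  \sum_(v <- W) g v * (\sum_(w <- W) G v w * (f v - f w)) =
  \sum_(v <- W) f v * (\sum_(w <- W) G v w * (g v - g w)).
Proof.
have expand p q : \sum_(v <- W) p v * (\sum_(w <- W) G v w * (q v - q w)) =
    \sum_(v <- W) \sum_(w <- W) G v w * p v * q v -
    \sum_(v <- W) \sum_(w <- W) G v w * p v * q w.
  rewrite -sumrB; apply: eq_bigr => v _; rewrite mulr_sumr -sumrB.
  by apply: eq_bigr => w _; ring.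
rewrite !expand; congr (_ - _).
  by apply: eq_bigr => v _; apply: eq_bigr => w _; ring.
rewrite exchange_big; apply: eq_bigr => v _; apply: eq_bigr => w _.
by rewrite (weight_sym G w v); ring.
Qed.

Lemma sum_delta g x : x \in W -> \sum_(v <- W) g v * (v == x)%:R = g x.
Proof.
move=> xW; rewrite (bigD1_seq x) //= ?fset_uniq// eqxx mulr1 big1 ?addr0//.
by move=> v /negPf->; rewrite mulr0.
Qed.

Lemma green_unit_potential x y f g : x \in W -> y \in W ->
  unit_potential G W x y f ->
  \sum_(v <- W) f v * (\sum_(w <- W) G v w * (g v - g w)) = g x - g y.
Proof.
move=> xW yW fP; rewrite -green -[in RHS](sum_delta g xW) -(sum_delta g yW) -sumrB.
by apply: eq_big_seq => v /fP ->; rewrite mulrBr.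
Qed.

(** The drop is the same for any two unit potentials [f] and [g]: by Green's
    identity both drops are the pairing of [g] with the Laplacian of [f]. *)
Lemma eff_res_drop x y f : x \in W -> y \in W -> unit_potential G W x y f ->
  eff_res G W x y = f x - f y.
Proof.
move=> xW yW fP; rewrite /eff_res; case: xgetP => [r _ [g gP ->]|/(_ (f x - f y))[]].
  rewrite -(green_unit_potential f xW yW gP) -(green_unit_potential g xW yW fP).
  by rewrite green.
by exists f.
Qed.

Lemma unit_potentialN x y f :
  unit_potential G W x y f -> unit_potential G W y x (fun v => - f v).
Proof.
move=> fP v vW; rewrite -opprB -fP// -sumrN.
by apply: eq_bigr => w _; ring.
Qed.

(** The default value 0 of an undefined effective resistance is what lets a
    nonzero value certify that a potential exists. *)
Lemma eff_res_neq0 x y : eff_res G W x y != 0 ->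
  exists f, unit_potential G W x y f.
Proof.
rewrite /eff_res; case: xgetP => [r _ [f fP _] _|_]; first by exists f.
by rewrite eqxx.
Qed.

Lemma term_le_sum (F : V -> R) w : w \in W -> (forall v, v \in W -> 0 <= F v) ->
  F w <= \sum_(v <- W) F v.
Proof.
move=> wW F0; rewrite (bigD1_seq w) //= ?fset_uniq// lerDl big_seq_cond.
by apply: sumr_ge0 => v /andP[/F0].
Qed.

(** Maximum principle: at a maximum other than the source [x] the net outflow is
    nonpositive, which forces all neighbours to be maxima as well. *)
Lemma unit_potential_max x y f v : connected_on G [set` W] -> x \in W -> v \in W ->
  unit_potential G W x y f -> f v <= f x.
Proof.
move=> conn xW vW fP.
have [m mW fm] : exists2 m, m \in W & forall u, u \in W -> f u <= f m.
  case: (@Order.TotalTheory.arg_maxP _ _ W (FSetSub xW) xpredT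
    (fun i => f (val i))) => // m _ H.
  by exists (val m) => [|u uW]; [exact: valP|exact: (H (FSetSub uW))].
suff H z : joined G [set` W] m z -> f z = f m \/ f x = f m.
  by have [->|->] := H _ (connected_on_joined conn mW xW); exact: fm.
elim=> [_|u w muW [um|->] uw /= wW]; try by [left|right].
have uW := joined_end muW.
have [->|ux] := eqVneq x u; first by right.
left; apply/eqP; rewrite eq_le fm//= leNgt; apply/negP => wm.
have F0 t : t \in W -> 0 <= G u t * (f u - f t).
  by move=> tW; rewrite mulr_ge0 ?weight_ge0// subr_ge0 um fm.
have := term_le_sum wW F0; rewrite fP// eq_sym (negPf ux) sub0r.
have : 0 < G u w * (f u - f w) by rewrite mulr_gt0// um subr_gt0.
by have : 0 <= (u == y)%:R :> R := ler0n _ _; lra.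
Qed.

End FiniteNetworks.

(** * The random walk and its Markov property *)

Section VertexWeight.
Variables (R : realType) (V : pointedType) (G : graph R V).
Implicit Types (x y z u v : V).

Lemma esum_ge_term (F : V -> \bar R) v : (forall u, 0 <= F u)%E ->
  (F v <= \esum_(u in [set: V]) F u)%E.
Proof.
by move=> F0; apply: esum_ge; exists [set v]; [split|rewrite fsbig_set1].
Qed.

Lemma vertex_weightE x :
  (vertex_weight G x)%:E = \esum_(y in [set: V]) (G x y)%:E.
Proof.
rewrite /vertex_weight fineK// ge0_fin_numE ?weight_summable//.
by apply: esum_ge0 => y _; rewrite lee_fin weight_ge0.
Qed.

Lemma weight_le x y : G x y <= vertex_weight G x.
Proof.
rewrite -lee_fin vertex_weightE; apply: (esum_ge_term (F := fun y => (G x y)%:E)).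
by move=> u; rewrite lee_fin weight_ge0.
Qed.

Lemma vertex_weight_ge0 x : 0 <= vertex_weight G x.
Proof. exact: le_trans (weight_ge0 G x x) (weight_le x x). Qed.

Lemma transition_ge0 x y : 0 <= transition G x y.
Proof. by rewrite divr_ge0 ?weight_ge0 ?vertex_weight_ge0. Qed.

(** Multiplied by [c_x], transition probabilities need no case distinction on
    whether [c_x] vanishes. *)
Lemma weight_transition x y : vertex_weight G x * transition G x y = G x y.
Proof.
rewrite /transition mulrCA; have [c0|c0] := eqVneq (vertex_weight G x) 0.
  apply/eqP; rewrite c0 mul0r mulr0 eq_sym eq_le weight_ge0 andbT -[leRHS]c0.
  exact: weight_le.
by rewrite divff ?mulr1.
Qed.

End VertexWeight.

Section PathSpace.
Variables (R : realType) (V : pointedType).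
Hypothesis V_countable : exists (D : set nat) (e : nat -> V), set_bij D setT e.
Implicit Types (x y z u v : V) (A : set (path_space V)).

Lemma bigcup_countable_measurable d (T : measurableType d) (B : set V)
    (F : V -> set T) :
  (forall v, B v -> measurable (F v)) -> measurable (\bigcup_(v in B) F v).
Proof.
move=> mF; have [D [e [_ _ De]]] := V_countable.
rewrite [X in measurable X](_ : _ = \bigcup_(i in [set i | B (e i)]) F (e i)).
  by apply: bigcup_measurable => i; exact: mF.
apply/seteqP; split=> [w [v Bv Fv]|w [i Bi Fi]]; last by exists (e i).
by have [i _ ei] := De v I; exists i; rewrite /= ei.
Qed.

Lemma measure_countable_bigcup d (T : measurableType d)
    (mu : {measure set T -> \bar R}) (F : V -> set T) :
  (forall v, measurable (F v)) -> (forall u v w, F u w -> F v w -> u = v) ->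
  mu (\bigcup_v F v) = \esum_(v in [set: V]) mu (F v).
Proof.
move=> mF tF; have [D [e ebij]] := V_countable; have [_ einj De] := ebij.
rewrite (reindex_esum _ _ _ _ ebij).
rewrite (_ : \bigcup_v F v = \bigcup_(i in D) F (e i)); last first.
  apply/seteqP; split=> [w [v _ Fv]|w [i Bi Fi]]; last by exists (e i).
  by have [i Di ei] := De v I; exists i; rewrite /= ?ei.
rewrite measure_bigcup ?nneseries_esum//; last first.
  move=> i j Di Dj [w [Fi Fj]]; apply: einj; rewrite ?inE//; exact: tF Fi Fj.
by congr esum; apply/seteqP; split=> i /=; rewrite inE.
Qed.

Lemma measurable_coordinate k (B : set V) :
  measurable [set w : path_space V | B (w k)].
Proof.
rewrite [X in measurable X](_ : _ = \bigcup_(v in B) [set w | w k = v]).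
  apply: bigcup_countable_measurable => v _; apply: sub_sigma_algebra.
  by exists k, v.
by apply/seteqP; split=> [w Bw|w [v Bv /= ->]//]; exists (w k).
Qed.

Definition path_shift (w : path_space V) : path_space V := fun k => w k.+1.

Lemma measurable_shift : measurable_fun setT path_shift.
Proof.
apply: (@measurability _ _ (path_space V) (path_space V) setT path_shift
  (@coordinate_events V)) => [|_ [_ [k [v ->]] <-]]; first by [].
move: k v => k v.
by rewrite setTI; exact: (measurable_coordinate k.+1 [set v]).
Qed.

(** A strict bound on [k] makes the whole space the cylinder of length 0. *)
Definition cylinder n (v : nat -> V) : set (path_space V) :=
  [set w | forall k, (k < n)%N -> w k = v k].

Definition cylinders : set (set (path_space V)) :=
  [set A | A = set0 \/ exists n s, A = cylinder n s].

Lemma setI_closed_cylinders : setI_closed cylinders.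
Proof.
have cyl m n (v v' : nat -> V) : (m <= n)%N -> cylinders (cylinder m v `&` cylinder n v').
  move=> mn; have [vv'|/existsNP[k /not_implyP[km kv]]] :=
    pselect (forall k, (k < m)%N -> v k = v' k).
  - right; exists n, v'; apply/seteqP; split=> [w []//|w wv'].
    by split=> // k km; rewrite wv' ?vv'//; exact: leq_trans mn.
  - left; apply/seteqP; split=> // w [wv wv'].
    by apply: kv; rewrite -wv// -wv'//; exact: leq_trans mn.
move=> _ _ [->|[m [v ->]]] [->|[n [v' ->]]]; rewrite ?setI0 ?set0I; try by left.
by have [mn|/ltnW nm] := leqP m n; [exact: cyl|rewrite setIC; exact: cyl].
Qed.

Lemma measurable_cylinder n (v : nat -> V) : measurable (cylinder n v).
Proof.
rewrite [X in measurable X](_ : _ = \bigcap_(k in [set k | (k < n)%N])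
  [set w : path_space V | [set v k] (w k)]).
  by apply: bigcap_measurableType => k _; exact: measurable_coordinate.
by apply/seteqP; split=> w wv k kn; exact: wv.
Qed.

(** Cylinders, unlike the coordinate events, are stable under intersection and
    are the sets whose probability is prescribed.  A coordinate event is a
    countable union of cylinders; the coordinates before the given one are fixed
    one after the other, from the last to the first. *)
Lemma measurable_path_space : @measurable _ (path_space V) = <<s cylinders >>.
Proof.
apply/seteqP; split; last first.
  apply: smallest_sub; first exact: sigma_algebra_measurable.
  by move=> _ [->|[n [v ->]]]; [exact: measurable0|exact: measurable_cylinder].
apply: smallest_sub; first exact: smallest_sigma_algebra.
move=> _ [k [a ->]].
have [D [e [_ _ De]]] := V_countable.
suff H d j (v : nat -> V) : (j + d = k)%N ->
    <<s cylinders >> ([set w | w k = a] `&` cylinder j v).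
  have := H k 0%N (fun=> point) (add0n k); rewrite (_ : _ `&` _ = [set w | w k = a])//.
  by apply/seteqP; split=> // w [].
elim: d j v => [|d IH] j v.
  rewrite addn0 => ->; apply: sub_sigma_algebra; right.
  (* All coordinates before [k] are fixed by now, so the set is a cylinder. *)
  exists k.+1, (fun i => if (i < k)%N then v i else a).
  apply/seteqP; split=> [w [wk wv] i|w wv].
    by rewrite ltnS leq_eqVlt; case: ltnP => [ik _|_ /orP[/eqP->|]//]; exact: wv.
  split=> [|i ik]; first by rewrite /= wv ?ltnn.
  by rewrite wv ?ik// ltnS ltnW.
move=> jd; rewrite (_ : _ `&` _ = \bigcup_i ([set w | w k = a] `&`
    cylinder j.+1 (fun l => if (l < j)%N then v l else e i))).
  by apply: sigma_algebra_bigcup => i; apply: IH; rewrite addSnnS.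
apply/seteqP; split=> [w [wk wv]|w [i _ [wk wv]]].
  have [i _ ei] := De (w j) I; exists i => //; split=> // l.
  rewrite ltnS leq_eqVlt; case: ltnP => [ik _|_ /orP[/eqP->|]//]; first exact: wv.
by split=> // l lj; rewrite wv ?lj// ltnS ltnW.
Qed.

End PathSpace.
Arguments path_shift {V}.
Arguments cylinder {V}.

Section MarkovProperty.
Variables (R : realType) (V : pointedType) (G : graph R V).
Variable P : V -> probability (path_space V) R.
Hypothesis P_law : forall x, random_walk_law G x (P x).
Implicit Types (x y z u v : V) (A : set (path_space V)).
Let V_countable := countable_enum G.

Lemma law_cylinder x n (v : nat -> V) : P x (cylinder n.+1 v) =
  ((v 0%N == x)%:R * \prod_(k < n) transition G (v k) (v k.+1))%:E.
Proof. exact: P_law. Qed.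

Lemma law_start x A : measurable A -> P x A = P x (A `&` [set w | w 0%N = x]).
Proof.
have mS : measurable [set w : path_space V | w 0%N = x].
  exact: (measurable_coordinate V_countable 0 [set x]).
have PS : P x [set w | w 0%N = x] = 1%E.
  rewrite (_ : [set w | _] = cylinder 1 (fun=> x)).
    by rewrite law_cylinder eqxx big_ord0 mulr1.
  by apply/seteqP; split=> w /= wx; [case|exact: wx].
move=> mA; rewrite (measureDI _ mA mS) [X in (X + _)%E](_ : _ = 0%E) ?add0e//.
apply/eqP; rewrite -measure_le0; have <- : P x (~` [set w | w 0%N = x]) = 0%E.
  by rewrite probability_setC// PS subee.
by rewrite le_measure ?inE//; do ?[exact: measurableD | exact: measurableC | move=> w []].
Qed.

Lemma law_eq_start x A (B : set (path_space V)) : measurable A -> measurable B ->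
  (forall w, w 0%N = x -> A w <-> B w) -> P x A = P x B.
Proof.
move=> mA mB AB; rewrite (law_start _ mA) (law_start _ mB); congr (P x _).
by apply/seteqP; split=> w [Aw /= wx]; split=> //; apply/(AB w wx).
Qed.

Let mcoord k v : measurable [set w : path_space V | w k = v].
Proof. exact: (measurable_coordinate V_countable k [set v]). Qed.

Lemma measurable_shift_preimage A : measurable A -> measurable (path_shift @^-1` A).
Proof.
by move=> mA; rewrite -[X in measurable X]setTI; exact: measurable_shift.
Qed.

Lemma law_first_step x u : P x [set w | w 1%N = u] = (transition G x u)%:E.
Proof.
rewrite law_start//.
rewrite (_ : _ `&` _ = cylinder 2 (fun k => if k is 0 then x else u)).
  by rewrite law_cylinder eqxx big_ord1 mul1r.
apply/seteqP; split=> [w [wu wx]|w wk]; first by case=> [|[|]].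
by split; [exact: (wk 1%N)|exact: (wk 0%N)].
Qed.

(** Both sides are finite measures in [A]; they agree on cylinders by the product
    formula for the law, hence everywhere. *)
Lemma markov_first_step x u A : measurable A ->
  P x (path_shift @^-1` A `&` [set w | w 1%N = u]) = ((transition G x u)%:E * P u A)%E.
Proof.
have mshift := measurable_shift V_countable.
pose m1 := mrestr (P x) (mcoord 1 u).
pose m2 := pushforward m1 path_shift.
pose m3 := mscale (NngNum (transition_ge0 G x u)) (P u).
apply: (measure_unique (@cylinders V) (fun=> setT) _ _ _ _ m2 m3).
- exact: measurable_path_space.
- exact: setI_closed_cylinders.
- by move=> _; right; exists 0%N, (fun=> point); apply/seteqP; split.
- by rewrite bigcup_const//; exists 0%N.
- move=> B CB; change (P x (path_shift @^-1` B `&` [set w | w 1%N = u]) =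
    ((transition G x u)%:E * P u B)%E); case: CB => [->|[[|n] [v ->]]].
    by rewrite preimage_set0 set0I !measure0 mule0.
    rewrite (_ : cylinder 0 v = setT) ?probability_setT ?mule1; last first.
      by apply/seteqP; split.
    by rewrite setTI law_first_step.
  rewrite law_cylinder -EFinM; have [vu|vu] := eqVneq (v 0%N) u; last first.
    rewrite mul0r mulr0 (_ : _ `&` _ = set0) ?measure0//.
    apply/seteqP; split=> // w [/(_ 0%N isT) + /= w1]; rewrite /path_shift w1.
    by move=> uv; move: vu; rewrite uv eqxx.
  rewrite law_start; last first.
    apply: measurableI => //; apply: measurable_shift_preimage.
    exact: measurable_cylinder.
  pose v' k := if k is j.+1 then v j else x.
  rewrite (_ : _ `&` _ = cylinder n.+2 v'); last first.
    apply/seteqP; split=> [w [[wv w1] wx] [//|k]|w wv]; first exact: wv.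
    by split; [split=> [k kn|]; [exact: (wv k.+1)|rewrite /= -vu; exact: (wv 1%N)]
      |exact: (wv 0%N)].
  by rewrite law_cylinder eqxx big_ord_recl /= vu !mul1r.
- move=> _; change (P x (path_shift @^-1` setT `&` [set w | w 1%N = u]) < +oo)%E.
  rewrite (le_lt_trans (probability_le1 _ _)) ?ltry//; apply: measurableI => //.
  exact: measurable_shift_preimage.
Qed.

Definition prob A x : R := fine (P x A).

Lemma probE A x : measurable A -> (prob A x)%:E = P x A.
Proof. by move=> mA; rewrite /prob fineK// fin_num_measure. Qed.

Lemma prob_ge0 A x : 0 <= prob A x.
Proof. by rewrite fine_ge0. Qed.

Lemma prob_le1 A x : measurable A -> prob A x <= 1.
Proof. by move=> mA; rewrite -lee_fin probE// probability_le1. Qed.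

(** In this form the Markov property says that [prob (path_shift @^-1` A)] is the
    average of [prob A] over the neighbours. *)
Lemma markov_property x A : measurable A ->
  \esum_(u in [set: V]) (G x u * prob A u)%:E =
  (vertex_weight G x * prob (path_shift @^-1` A) x)%:E.
Proof.
move=> mA; have mSA := measurable_shift_preimage mA.
rewrite EFinM (probE _ mSA).
pose mu := mscale (NngNum (vertex_weight_ge0 G x)) (P x).
pose F u := path_shift @^-1` A `&` [set w | w 1%N = u].
have -> : path_shift @^-1` A = \bigcup_u F u.
  by apply/seteqP; split=> [w Aw|w [u _ []]//]; exists (w 1%N).
transitivity (\esum_(u in [set: V]) mu (F u)).
  apply: eq_esum => u _; rewrite /mu /mscale /= (markov_first_step _ _ mA).
  by rewrite muleA -EFinM weight_transition EFinM probE.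
apply/esym/(measure_countable_bigcup V_countable mu).
- by move=> u; apply: measurableI.
- by move=> u v w [_ /= <-] [_ /= <-].
Qed.

(** At a vertex of weight 0 all transition probabilities would vanish, and the
    walk would have nowhere to go at time 1. *)
Lemma vertex_weight_gt0 x : 0 < vertex_weight G x.
Proof.
rewrite lt_def vertex_weight_ge0 andbT; apply/eqP => cx.
have : (1%:E : \bar R) = 0%E; last by move=> [] /eqP; rewrite oner_eq0.
rewrite -(probability_setT (P x)).
rewrite (_ : setT = \bigcup_u [set w : path_space V | w 1%N = u]); last first.
  by apply/seteqP; split=> // w _; exists (w 1%N).
rewrite (measure_countable_bigcup V_countable (P x)) => [|u|u v w <-//].
  by apply: esum1 => u _; rewrite [LHS]law_first_step /transition cx invr0 mulr0.
exact: mcoord.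
Qed.

End MarkovProperty.

(** * Weighted sums over neighbours *)

Section WeightedSums.
Variables (R : realType) (V : pointedType) (G : graph R V).
Implicit Types (u v w x y : V) (W : {fset V}) (s t p q : V -> R).

(** Every function averaged below has values in [0, 1]; then the sums are finite
    and can be handled as real numbers. *)
Definition unit_valued s := forall u, 0 <= s u <= 1.

Definition wsum v s : R := fine (\esum_(u in [set: V]) (G v u * s u)%:E).

Lemma wsumE v s : unit_valued s ->
  (wsum v s)%:E = \esum_(u in [set: V]) (G v u * s u)%:E.
Proof.
move=> s01; rewrite /wsum fineK// ge0_fin_numE; last first.
  apply: esum_ge0 => u _; have /andP[s0 _] := s01 u.
  by rewrite lee_fin mulr_ge0 ?weight_ge0.
apply: le_lt_trans (weight_summable G v); apply: le_esum => u _.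
by have /andP[_ s1] := s01 u; rewrite lee_fin ler_piMr ?weight_ge0.
Qed.

Lemma wsum_ge v s W : unit_valued s -> \sum_(u <- W) G v u * s u <= wsum v s.
Proof.
move=> s01; rewrite -lee_fin wsumE// -sumEFin; apply: esum_ge.
exists [set` W]; first by split=> //; exact: finite_fset.
by rewrite fsbig_finite ?set_fsetK//=; exact: finite_fset.
Qed.

Lemma wsum_le v s C : unit_valued s ->
  (forall W, \sum_(u <- W) G v u * s u <= C) -> wsum v s <= C.
Proof.
move=> s01 sC; rewrite -lee_fin wsumE//; apply: ge_ereal_sup => _ [A [finA _] <-].
by rewrite fsumEFin// lee_fin fsbig_finite.
Qed.

Lemma unit_valued1 : unit_valued (fun=> 1).
Proof. by move=> u; rewrite ler01 lexx. Qed.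

Lemma wsum1 v : wsum v (fun=> 1) = vertex_weight G v.
Proof.
apply/EFin_inj; rewrite wsumE ?vertex_weightE; last exact: unit_valued1.
by apply: eq_esum => u _; rewrite mulr1.
Qed.

Lemma eq_wsum v s t : (forall u, adjacent G v u -> s u = t u) ->
  wsum v s = wsum v t.
Proof.
move=> st; congr fine; apply: eq_esum => u _; congr EFin.
have := weight_ge0 G v u; rewrite le_eqVlt => /predU1P[<-|/st->//].
by rewrite !mul0r.
Qed.

Lemma weight_eq0 v u : ~ adjacent G v u -> G v u = 0.
Proof.
move=> /negP; rewrite /adjacent -leNgt => G0.
by apply/eqP; rewrite eq_le G0 weight_ge0.
Qed.

Lemma sum_fset_le (F : V -> R) W W' : (forall u, 0 <= F u) -> (W `<=` W')%fset ->
  \sum_(u <- W) F u <= \sum_(u <- W') F u.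
Proof.
move=> F0 WW'; have -> : \sum_(u <- W) F u = \sum_(u <- W) (if u \in W then F u else 0).
  by apply: eq_big_seq => u ->.
rewrite (big_fset_incl _ WW'); last by move=> u _ /negPf->.
by apply: ler_sum => u _; case: ifP.
Qed.

Lemma wsum_fset v s W : unit_valued s ->
  (forall u, u \notin W -> G v u * s u = 0) ->
  wsum v s = \sum_(u <- W) G v u * s u.
Proof.
move=> s01 s0; apply/eqP; rewrite eq_le wsum_ge// andbT; apply: wsum_le => // W'.
apply: (@le_trans _ _ (\sum_(u <- (W `|` W')%fset) G v u * s u)).
  apply: sum_fset_le; last exact: fsubsetUr.
  by move=> u; have /andP[u0 _] := s01 u; rewrite mulr_ge0 ?weight_ge0.
rewrite -(big_fset_incl _ (fsubsetUl W W'))//.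
by move=> u _; exact: s0.
Qed.

Lemma wsumZ_le v s a C : unit_valued s -> 0 <= a ->
  (forall W, a * \sum_(u <- W) G v u * s u <= C) -> a * wsum v s <= C.
Proof.
move=> s01; rewrite le_eqVlt => /predU1P[<-|a0] sC.
  by rewrite mul0r; have := sC fset0; rewrite mul0r.
rewrite mulrC -ler_pdivlMr//; apply: wsum_le => // W.
by rewrite ler_pdivlMr// mulrC.
Qed.

(** Superadditivity is all that is needed of linearity, and it follows from
    finite sums alone. *)
Lemma wsum_comb v a b p q s : 0 <= a -> 0 <= b ->
  unit_valued p -> unit_valued q -> unit_valued s ->
  (forall u, a * p u + b * q u <= s u) ->
  a * wsum v p + b * wsum v q <= wsum v s.
Proof.
move=> a0 b0 p01 q01 s01 pqs; rewrite -lerBrDr; apply: wsumZ_le => // W1.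
rewrite lerBrDr addrC -lerBrDr; apply: wsumZ_le => // W2; rewrite lerBrDr.
pose W := (W1 `|` W2)%fset; apply: le_trans (wsum_ge v W s01).
have mono t W' : unit_valued t -> (W' `<=` W)%fset ->
    \sum_(u <- W') G v u * t u <= \sum_(u <- W) G v u * t u.
  move=> t01; apply: sum_fset_le => u.
  by have /andP[t0 _] := t01 u; rewrite mulr_ge0 ?weight_ge0.
apply: le_trans (lerD (ler_wpM2l b0 (mono q W2 q01 (fsubsetUr _ _)))
  (ler_wpM2l a0 (mono p W1 p01 (fsubsetUl _ _)))) _.
rewrite !mulr_sumr -big_split; apply: ler_sum => u _ /=.
rewrite !(mulrCA _ (G v u)) -mulrDr addrC.
by rewrite ler_wpM2l ?weight_ge0.
Qed.

(** If the sums of [p <= s] agree, this bounds [s u - p u] at each neighbour [u]: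
    two ordered functions with the same average coincide at the neighbours. *)
Lemma wsum_gap v p s u : unit_valued p -> unit_valued s -> (forall w, p w <= s w) ->
  wsum v p + G v u * (s u - p u) <= wsum v s.
Proof.
move=> p01 s01 ps; pose d w : R := (w == u)%:R.
have d01 : unit_valued d by move=> w; rewrite /d ler0n lern1 leq_b1.
have Gd : G v u <= wsum v d.
  by apply: le_trans (wsum_ge v [fset u]%fset d01); rewrite big_seq_fset1 /d eqxx mulr1.
have psu : 0 <= s u - p u by rewrite subr_ge0.
apply: (@le_trans _ _ (1 * wsum v p + (s u - p u) * wsum v d)).
  by rewrite mul1r lerD2l mulrC ler_wpM2l.
apply: wsum_comb => // w; rewrite mul1r /d.
by case: eqVneq => [->|_]; rewrite ?mulr1 ?mulr0 ?addr0// addrC subrK.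
Qed.

Lemma le_wsum v p s : unit_valued p -> unit_valued s -> (forall w, p w <= s w) ->
  wsum v p <= wsum v s.
Proof.
move=> p01 s01 ps; have := wsum_gap v v p01 s01 ps.
by rewrite weight_irr mul0r addr0.
Qed.

Lemma wsum0 v : wsum v (fun=> 0) = 0.
Proof. by rewrite /wsum esum1// => u _; rewrite mulr0. Qed.

End WeightedSums.

(** * Hitting probabilities *)

Section HittingEvents.
Variables (R : realType) (V : pointedType) (G : graph R V).
Variable P : V -> probability (path_space V) R.
Hypothesis P_law : forall x, random_walk_law G x (P x).
Implicit Types (u v x y a b : V) (S : set V) (s : V -> R).
Let V_countable := countable_enum G.

Let measurable_tail := @measurable_shift_preimage R V G.

(** For [S] a singleton [{x}] this is the event [tau_y < tau_x], and for [S] empty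
    it is [tau_y < oo]. *)
Definition hits S y : set (path_space V) :=
  [set w | exists k, w k = y /\ forall i, (i <= k)%N -> ~ S (w i)].

Definition hits_by n S y : set (path_space V) :=
  [set w | exists k, [/\ (k <= n)%N, w k = y & forall i, (i <= k)%N -> ~ S (w i)]].

Let measurable_hits_at k S y : measurable
  ([set w : path_space V | w k = y] `&` [set w : path_space V | forall i, (i <= k)%N -> ~ S (w i)]).
Proof.
apply: measurableI; first exact: (measurable_coordinate V_countable k [set y]).
rewrite [X in measurable X](_ : _ = \bigcap_(i in [set i | (i <= k)%N])
    [set w : path_space V | (~` S) (w i)]) //.
by apply: bigcap_measurableType => i _; exact: measurable_coordinate.
Qed.

Lemma measurable_hits_by n S y : measurable (hits_by n S y).
Proof.
rewrite [X in measurable X](_ : _ = \bigcup_(k in [set k | (k <= n)%N])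
    ([set w : path_space V | w k = y] `&`
     [set w : path_space V | forall i, (i <= k)%N -> ~ S (w i)])).
  by apply: bigcup_measurable.
by apply/seteqP; split=> w [k]; [move=> [? ? ?]|move=> ? []]; exists k.
Qed.

Lemma hits_bigcup S y : hits S y = \bigcup_n hits_by n S y.
Proof.
apply/seteqP; split=> w; first by move=> [k [wk Sk]]; exists k => //; exists k.
by move=> [n _ [k [_ wk Sk]]]; exists k.
Qed.

Lemma measurable_hits S y : measurable (hits S y).
Proof.
by rewrite hits_bigcup; apply: bigcup_measurable => n _; exact: measurable_hits_by.
Qed.

Let mhits := measurable_hits.
Let mhits_by := measurable_hits_by.

Lemma hits_byS n S y w : ~ S (w 0%N) -> w 0%N <> y ->
  hits_by n.+1 S y w <-> hits_by n S y (path_shift w).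
Proof.
move=> S0 w0; split=> [[[|k] [kn wk Sk]]//|[k [kn wk Sk]]].
  by exists k; split=> // i ik; exact: (Sk i.+1).
by exists k.+1; split=> // -[|i] ik //; exact: Sk.
Qed.

Lemma hits_shift S y w : ~ S (w 0%N) -> w 0%N <> y ->
  hits S y w <-> hits S y (path_shift w).
Proof.
move=> S0 w0; split=> [[[|k] [wk Sk]]//|[k [wk Sk]]].
  by exists k; split=> // i ik; exact: (Sk i.+1).
by exists k.+1; split=> // -[|i] ik //; exact: Sk.
Qed.

Definition hit_prob S y v := prob P (hits S y) v.

Lemma prob_unit (A : set (path_space V)) : measurable A -> unit_valued (prob P A).
Proof. by move=> mA v; rewrite prob_ge0 prob_le1. Qed.

Lemma hit_prob_unit S y : unit_valued (hit_prob S y).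
Proof. exact: prob_unit. Qed.

Lemma prob_eq_start v (A B : set (path_space V)) : measurable A -> measurable B ->
  (forall w, w 0%N = v -> A w <-> B w) -> prob P A v = prob P B v.
Proof. by move=> mA mB AB; rewrite /prob (law_eq_start P_law mA mB). Qed.

Lemma hit_prob_avoided S y v : S v -> hit_prob S y v = 0.
Proof.
move=> Sv; rewrite /hit_prob (prob_eq_start (mhits S y) measurable0) /prob ?measure0//.
by move=> w wv; split=> // -[k [_ /(_ 0%N isT)]]; rewrite wv.
Qed.

Lemma hit_prob_target S y : ~ S y -> hit_prob S y y = 1.
Proof.
move=> Sy; rewrite /hit_prob (prob_eq_start (mhits S y) measurableT).
  by rewrite /prob probability_setT.
by move=> w wy; split=> // _; exists 0%N; split=> // i; rewrite leqn0 => /eqP->; rewrite wy.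
Qed.

Lemma wsum_prob v (A : set (path_space V)) : measurable A ->
  wsum G v (prob P A) = vertex_weight G v * prob P (path_shift @^-1` A) v.
Proof.
move=> mA; apply: EFin_inj; rewrite -(markov_property P_law)// wsumE//; exact: prob_unit.
Qed.

Lemma hit_prob_harmonic S y v : ~ S v -> v <> y ->
  wsum G v (hit_prob S y) = vertex_weight G v * hit_prob S y v.
Proof.
move=> Sv vy; rewrite wsum_prob//; congr (_ * _); apply: prob_eq_start => //.
  exact: measurable_tail.
by move=> w wv; rewrite hits_shift ?wv.
Qed.

Definition superharmonic_at s v := wsum G v s <= vertex_weight G v * s v.

Lemma prob_hits_by_le n S y v : prob P (hits_by n S y) v <= hit_prob S y v.
Proof.
rewrite -lee_fin !probE//; apply: le_measure; rewrite ?inE//.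
by move=> w [k [_ wk Sk]]; exists k.
Qed.

Lemma prob_hits_by0 S y v : v <> y -> prob P (hits_by 0 S y) v = 0.
Proof.
move=> vy; rewrite (prob_eq_start (B := set0)) ?/prob ?measure0//.
move=> w wv; split=> // -[k []]; rewrite leqn0 => /eqP-> wy.
by case: vy; rewrite -wv -wy.
Qed.

Lemma wsum_hits_by n S y v : ~ S v -> v <> y ->
  wsum G v (prob P (hits_by n S y)) =
  vertex_weight G v * prob P (hits_by n.+1 S y) v.
Proof.
move=> Sv vy; rewrite wsum_prob//; congr (_ * _); apply: prob_eq_start => //.
  exact: measurable_tail.
by move=> w wv; rewrite hits_byS ?wv.
Qed.

Lemma cvg_prob_hits_by S y v :
  prob P (hits_by n S y) v @[n --> \oo] --> hit_prob S y v.
Proof.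
apply: fine_cvg; rewrite probE// hits_bigcup.
apply: nondecreasing_cvg_mu => [n||m n mn]; first by [].
  by rewrite -hits_bigcup.
apply/subsetPset => w [k [km wk Sk]]; exists k; split=> //; exact: leq_trans mn.
Qed.

(** One step of the walk turns the horizon [n.+1] into [n], and the
    superharmonicity of [s] absorbs the average. *)
Lemma two_point_hits_by n a b s v : unit_valued s -> a <> b ->
  (forall u, u <> a -> u <> b -> superharmonic_at s u) ->
  s a * prob P (hits_by n [set b] a) v + s b * prob P (hits_by n [set a] b) v <= s v.
Proof.
move=> s01 ab sup; have s0 u : 0 <= s u by have /andP[] := s01 u.
have avoided m c d : prob P (hits_by m [set c] d) c = 0.
  apply/le_anti; rewrite prob_ge0 andbT; apply: le_trans (prob_hits_by_le _ _ _ _) _.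
  by rewrite hit_prob_avoided.
elim: n v => [|n IH] v; have [->|/eqP va] := eqVneq v a.
- by rewrite avoided mulr0 addr0 ler_piMr// prob_le1.
- have [->|/eqP vb] := eqVneq v b.
    by rewrite avoided mulr0 add0r ler_piMr// prob_le1.
  by rewrite !prob_hits_by0// !mulr0 addr0.
- by rewrite avoided mulr0 addr0 ler_piMr// prob_le1.
- have [->|/eqP vb] := eqVneq v b.
    by rewrite avoided mulr0 add0r ler_piMr// prob_le1.
  rewrite -(ler_pM2l (vertex_weight_gt0 P_law v)) mulrDr !(mulrCA (vertex_weight G v)).
  rewrite -!wsum_hits_by//; apply: le_trans (sup v va vb).
  by apply: wsum_comb => //; exact: prob_unit.
Qed.

(** Optional stopping at the first visit to [a] or [b]: a nonnegative
    function that is superharmonic elsewhere dominates the expectation of its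
    value there. *)
Lemma two_point_minimal a b s v : unit_valued s -> a <> b ->
  (forall u, u <> a -> u <> b -> superharmonic_at s u) ->
  s a * hit_prob [set b] a v + s b * hit_prob [set a] b v <= s v.
Proof.
move=> s01 ab sup.
have cvg_n : s a * prob P (hits_by n [set b] a) v +
    s b * prob P (hits_by n [set a] b) v @[n --> \oo] -->
    s a * hit_prob [set b] a v + s b * hit_prob [set a] b v.
  by apply: cvgD; apply: cvgMl_tmp; exact: cvg_prob_hits_by.
apply: (cvgr_to_le cvg_n); apply: nearW => n; exact: two_point_hits_by.
Qed.

(** Positivity spreads backwards along the path, since the value at a vertex is
    an average over its neighbours. *)
Lemma hit_prob_gt0 S y v : joined G (~` S) v y -> 0 < hit_prob S y v.
Proof.
move=> /joined_sym; elim=> [Sy|u {}v yu hu uv Sv].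
  by rewrite hit_prob_target ?ltr01.
have [->|/eqP vy] := eqVneq v y; first by rewrite hit_prob_target ?ltr01//; exact: joined_start yu.
rewrite -(pmulr_rgt0 _ (vertex_weight_gt0 P_law v)) -hit_prob_harmonic//.
apply: lt_le_trans (wsum_ge G v [fset u]%fset (hit_prob_unit S y)).
by rewrite big_seq_fset1 mulr_gt0//; exact: adjacent_sym.
Qed.

(** The event says something about the positive times only, apart from paths
    that start at [y]; this shows its measurability and gives access to the
    Markov property. *)
Lemma escape_eventE x y :
  [set w : path_space V | (hitting_time R y w < return_time R x w)%E] =
  [set w | w 0%N = y] `|` path_shift @^-1` hits [set x] y.
Proof.
apply/seteqP; split=> w.
  move=> /ereal_inf_lt[_ [k wk <-] kB].
  have nB i : (0 < i <= k)%N -> w i <> x.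
    move=> /andP[i0 ik] wi; move: kB; apply/negP; rewrite -leNgt.
    apply: (@le_trans _ _ i%:R%:E); last by rewrite lee_fin ler_nat.
    by apply: ereal_inf_lbound; exists i.
  case: k wk nB {kB} => [|k] wk nB; first by left.
  by right; exists k; split=> // i ik; exact: (nB i.+1).
move=> wE; suff [k wk kB] : exists2 k, w k = y & forall i, (0 < i <= k)%N -> w i <> x.
  apply: (@le_lt_trans _ _ k%:R%:E); first by apply: ereal_inf_lbound; exists k.
  apply: (@lt_le_trans _ _ k.+1%:R%:E); first by rewrite lte_fin ltr_nat.
  apply/ereal_infP => _ [i [i0 wi] <-]; rewrite lee_fin ler_nat ltnNge.
  by apply/negP => ik; apply: (kB i) => //; rewrite ik andbT.
case: wE => [w0|[k [wk kB]]]; first by exists 0%N => // -[].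
by exists k.+1 => // -[//|i] /= ik; exact: kB.
Qed.

Lemma return_eventE x :
  [set w : path_space V | (return_time R x w < +oo)%E] =
  path_shift @^-1` hits set0 x.
Proof.
apply/seteqP; split=> w.
  move=> /ereal_inf_lt[_ [[|k] [//_ wk] _] _]; exists k; split=> // i _ [].
move=> [k [wk _]]; apply: (@le_lt_trans _ _ k.+1%:R%:E); last by rewrite ltry.
by apply: ereal_inf_lbound; exists k.+1.
Qed.

Lemma escape_probabilityE x y : x <> y ->
  vertex_weight G x * escape_probability P x y = wsum G x (hit_prob [set x] y).
Proof.
move=> xy; rewrite wsum_prob// /escape_probability escape_eventE.
congr (_ * _); apply: prob_eq_start.
- apply: measurableU; first exact: (measurable_coordinate V_countable 0 [set y]).
  exact: measurable_tail.
- exact: measurable_tail.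
- by move=> w wx; split=> [[/= wy|//]|]; [case: xy; rewrite -wx -wy|right].
Qed.

Lemma return_probability_lt1 x : transient P ->
  wsum G x (hit_prob set0 x) < vertex_weight G x.
Proof.
move=> /(_ x); rewrite return_eventE => ret.
rewrite wsum_prob// -[ltRHS]mulr1 ltr_pM2l ?(vertex_weight_gt0 P_law)//.
by rewrite -lte_fin probE//; exact: measurable_tail.
Qed.

(** After its last visit to [x], a path from [x] to [y] starts at a neighbour of
    [x] and avoids [x]. *)
Lemma escape_gt0 x y : connected_graph G -> x <> y ->
  0 < wsum G x (hit_prob [set x] y).
Proof.
move=> conn xy.
have exit z : joined G setT y z -> joined G (~` [set x]) y z \/
    exists2 v, adjacent G x v & joined G (~` [set x]) y v.
  elim=> [_|u v _ [yu|] uv _]; [by left; apply: joined_refl; exact: nesym| |by right].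
  have [vx|/eqP vx] := eqVneq v x; last by left; apply: joined_step uv vx.
  by right; exists u => //; apply: adjacent_sym; rewrite -vx.
have [/joined_end/(_ erefl)//|[v xv yv]] := exit x (connected_on_joined conn I I).
apply: lt_le_trans (wsum_ge G x [fset v]%fset (hit_prob_unit [set x] y)).
by rewrite big_seq_fset1 mulr_gt0// hit_prob_gt0//; exact: joined_sym.
Qed.

End HittingEvents.

(** * Free effective resistance *)

Section FreeResistance.
Variables (R : realType) (V : pointedType) (G : graph R V).
Implicit Types (u v w x y : V) (W : {fset V}) (Vn : nat -> {fset V}).

Lemma exhaustion_fset Vn W : exhaustion G Vn ->
  exists N, forall n, (N <= n)%N -> (W `<=` Vn n)%fset.
Proof.
move=> [incr cover _]; have [N HN] := choice cover.
have mono m n : (m <= n)%N -> (Vn m `<=` Vn n)%fset.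
  elim: n => [|n IH]; first by rewrite leqn0 => /eqP->; exact: fsubset_refl.
  rewrite leq_eqVlt ltnS => /predU1P[->|/IH mn]; first exact: fsubset_refl.
  exact: fsubset_trans mn (incr n).
exists (\max_(w <- W) N w)%N => n Wn; apply/fsubsetP => w wW.
apply: (fsubsetP (mono (N w) n _)) (HN w); apply: leq_trans Wn.
exact: leq_bigmax_seq.
Qed.

Lemma exhaustion_near Vn W : exhaustion G Vn ->
  \forall n \near \oo, (W `<=` Vn n)%fset.
Proof. by move=> /(exhaustion_fset W)[N HN]; exists N. Qed.

(** Uniqueness of the limit requires that there be an exhaustion at all. *)
Lemma free_eff_res_eq x y r : connected_graph G ->
  (forall Vn, exhaustion G Vn -> eff_res G (Vn n) x y @[n --> \oo] --> r) ->
  free_eff_res G x y = r.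
Proof.
move=> conn lim_r; have [Vn exVn] := exhaustion_exists conn.
rewrite /free_eff_res; case: xgetP => [r' _ lim_r'|/(_ r)]; last by case.
exact: (cvg_unique _ (lim_r' _ exVn) (lim_r _ exVn)).
Qed.

(** A nonzero value cannot be the default of an undefined limit, so convergence
    along every exhaustion comes without Rayleigh monotonicity. *)
Lemma free_eff_res_cvg Vn x y : free_eff_res G x y != 0 -> exhaustion G Vn ->
  eff_res G (Vn n) x y @[n --> \oo] --> free_eff_res G x y.
Proof.
by rewrite /free_eff_res; case: xgetP => [r _ + _|]; [exact|rewrite eqxx].
Qed.

End FreeResistance.

(** * The identity on a line *)

Section Line.
Variables (R : realType) (V : pointedType) (G : graph R V).
Variable P : V -> probability (path_space V) R.
Hypothesis P_law : forall x, random_walk_law G x (P x).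
Variable phi : V -> int.
Hypothesis phi_inj : injective phi.
Hypothesis phi_adj : forall u v, adjacent G u v -> `|phi u - phi v| = 1.
Implicit Types (u v w z : V) (W : {fset V}).

(** Discrete intermediate value theorem, with [phi_inj] identifying the vertex
    that has the intermediate value. *)
Lemma between_mem W x y z : connected_on G [set` W] -> x \in W -> y \in W ->
  phi x <= phi z <= phi y -> z \in W.
Proof.
move=> conn xW yW /andP[xz zy].
suff H w : joined G [set` W] x w -> phi z <= phi w -> z \in W.
  exact: H (connected_on_joined conn xW yW) zy.
elim=> [_ zx|u {}w _ IH uw wW zw].
  by rewrite (_ : z = x)//; apply/phi_inj/le_anti; rewrite xz zx.
have [/IH//|uz] := leP (phi z) (phi u).
rewrite (_ : z = w)//; apply: phi_inj.
by have := phi_adj uw; lia.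
Qed.

(** The indicator of the open half-line beyond [x] is superharmonic off [x]
    and [y], so it dominates the hitting probability. *)
Lemma hit_prob_behind x y v : phi x < phi y -> phi v < phi x ->
  hit_prob P [set x] y v = 0.
Proof.
move=> xy vx; pose s w : R := (phi x < phi w)%R%:R.
have s01 : unit_valued s by move=> w; rewrite /s ler0n lern1 leq_b1.
have yx : y <> x by move=> yx; move: xy; rewrite yx ltxx.
have sup u : u <> y -> u <> x -> superharmonic_at G s u.
  move=> _ ux; rewrite /superharmonic_at.
  have [xu|ux'] := boolP (phi x < phi u).
    rewrite {2}/s xu mulr1 -wsum1; apply: le_wsum => // [|w]; first exact: unit_valued1.
    by rewrite /s lern1 leq_b1.
  rewrite (eq_wsum (t := fun=> 0)) ?wsum0 {1}/s ?(negPf ux') ?mulr0// => w uw.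
  rewrite /s; case: ltP => // xw; have xu : phi u <> phi x by move/phi_inj.
  by have := phi_adj uw; move: ux'; rewrite -leNgt; lia.
have := two_point_minimal P_law v s01 yx sup.
rewrite /s xy ltxx mul0r addr0 mul1r ltNge (ltW vx) /= => h0.
by apply/le_anti; rewrite h0; have /andP[] := hit_prob_unit G P [set x] y v.
Qed.

(** Between [x] and [y] all edges of the graph belong to the finite network, so
    the hitting probability is harmonic there as well.  Beyond [y] it has to be
    replaced by 1, because the walk on the infinite graph may escape there. *)
Lemma line_unit_potential W x y : connected_graph G -> phi x < phi y ->
  connected_on G [set` W] -> x \in W -> y \in W ->
  exists2 f, unit_potential G W x y f &
    f x - f y = (wsum G x (hit_prob P [set x] y))^-1.
Proof.
move=> connG xy conn xW yW; set h := hit_prob P [set x] y; set L := wsum _ _ _.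
have L0 : L != 0 by rewrite gt_eqF// escape_gt0// => e; move: xy; rewrite e ltxx.
have xy' : x != y by apply: contraTneq xy => ->; rewrite ltxx.
have h01 : unit_valued h := hit_prob_unit G P [set x] y.
have hx : h x = 0 by apply: (hit_prob_avoided P_law).
have hy : h y = 1 by apply: (hit_prob_target P_law) => /= e; rewrite e eqxx in xy'.
pose g v := if phi y <= phi v then 1 else h v.
have gh v : phi v <= phi y -> g v = h v.
  move=> vy; rewrite /g; case: ifP => // yv.
  by rewrite (_ : v = y) ?hy//; apply/phi_inj/le_anti; rewrite vy yv.
have inW u v : phi x < phi v -> phi v < phi y -> adjacent G v u -> u \in W.
  move=> xv vy vu; apply: (between_mem conn xW yW).
  by have := phi_adj vu; lia.
have outW0 u v : phi x < phi v -> phi v < phi y -> u \notin W -> G v u = 0.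
  by move=> xv vy /negP uW; apply: weight_eq0 => /(inW _ _ xv vy).
have xL : \sum_(w <- W) G x w * (g x - g w) = - L.
  rewrite /L (wsum_fset (W := W))// => [|u uW].
    rewrite -sumrN; apply: eq_big_seq => w _; rewrite [g x]gh ?(ltW xy)// hx sub0r mulrN.
    have [xw|nxw] := pselect (adjacent G x w); last by rewrite weight_eq0 ?mul0r.
    by rewrite gh//; have := phi_adj xw; lia.
  have [xu|nxu] := pselect (adjacent G x u); last by rewrite weight_eq0 ?mul0r.
  have xu1 := phi_adj xu; have [xltu|ulex] := ltP (phi x) (phi u).
    have : u \in W by apply: (between_mem conn xW yW); lia.
    by rewrite (negPf uW).
  by rewrite [h u]hit_prob_behind ?mulr0//; lia.
have rest v : v \in W -> v != x -> v != y ->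
    \sum_(w <- W) G v w * (g v - g w) = 0.
  move=> vW /eqP vx /eqP vy.
  have [vltx|] := ltP (phi v) (phi x).
    apply: big1 => w _; have [vw|nvw] := pselect (adjacent G v w); last first.
      by rewrite weight_eq0 ?mul0r.
    have wx : phi w <= phi x by have := phi_adj vw; lia.
    rewrite !gh ?(le_trans wx)// ?(ltW xy) ?(ltW (lt_trans vltx xy))//.
    rewrite [h v]hit_prob_behind//; move: wx; rewrite le_eqVlt => /predU1P[/phi_inj->|wx].
      by rewrite hx subrr mulr0.
    by rewrite [h w]hit_prob_behind// subrr mulr0.
  rewrite le_eqVlt => /predU1P[/phi_inj/esym//|xv].
  have [ylev|vlty] := leP (phi y) (phi v).
    apply: big1 => w _; have [vw|nvw] := pselect (adjacent G v w); last first.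
      by rewrite weight_eq0 ?mul0r.
    have yv : phi y <> phi v by move/phi_inj/esym.
    have yw : phi y <= phi w by have := phi_adj vw; lia.
    by rewrite /g ylev yw subrr mulr0.
  have one01 := @unit_valued1 R V.
  transitivity (vertex_weight G v * h v - wsum G v h); last first.
    by rewrite [wsum G v h](hit_prob_harmonic P_law)// subrr.
  rewrite -wsum1 (wsum_fset (W := W))// => [|u uW]; last by rewrite (outW0 u) ?mul0r.
  rewrite (wsum_fset (W := W))// => [|u uW]; last by rewrite (outW0 u) ?mul0r.
  rewrite mulr_suml -sumrB; apply: eq_big_seq => w wW; rewrite [g v]gh ?(ltW vlty)//.
  have [vw|nvw] := pselect (adjacent G v w); last by rewrite weight_eq0//; ring.
  by rewrite gh; [ring|have := phi_adj vw; lia].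
(* The Laplacian of [g] has total sum 0, so the current into [y] is that out
   of [x]. *)
have yL : \sum_(w <- W) G y w * (g y - g w) = L.
  have : \sum_(v <- W) \sum_(w <- W) G v w * (g v - g w) = 0.
    transitivity (\sum_(v <- W) 1 * \sum_(w <- W) G v w * (g v - g w)).
      by apply: eq_bigr => v _; rewrite mul1r.
    rewrite (green G W g (fun=> 1)); apply: big1 => v _.
    by rewrite big1 ?mulr0// => w _; rewrite subrr mulr0.
  set D := fun v => \sum_(w <- W) G v w * (g v - g w).
  rewrite (eq_big_seq (fun v => D y * (v == y)%:R - L * (v == x)%:R)) => [|v vW].
    by rewrite sumrB !(@sum_delta R V W)// => /eqP; rewrite subr_eq0 => /eqP.
  have [->|vx] := eqVneq v x; first by rewrite xL (negPf xy') mulr0 sub0r mulr1.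
  by have [->|vy] := eqVneq v y; [rewrite mulr1 mulr0 subr0|rewrite rest// !mulr0 subr0].
exists (fun v => - g v / L); last by rewrite !gh ?(ltW xy)// hx hy; field.
move=> v vW; rewrite [X in X = _](_ : _ = - (\sum_(w <- W) G v w * (g v - g w)) / L); last first.
  by rewrite [RHS]mulNr mulr_suml -sumrN; apply: eq_bigr => w _; field.
have [->|vx] := eqVneq v x; first by rewrite xL (negPf xy') opprK divff// subr0.
have [->|vy] := eqVneq v y; first by rewrite yL mulNr divff// sub0r.
by rewrite rest// oppr0 mul0r addr0.
Qed.

Lemma line_free_eff_res x y : connected_graph G -> phi x < phi y ->
  free_eff_res G x y = (wsum G x (hit_prob P [set x] y))^-1.
Proof.
move=> conn xy; apply: free_eff_res_eq => // Vn exVn.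
apply: cvg_near_cst; near=> n; have [_ _ connVn] := exVn.
have xyVn : ([fset x; y] `<=` Vn n)%fset by near: n; exact: (exhaustion_near _ exVn).
have xW : x \in Vn n by apply: (fsubsetP xyVn); rewrite !inE eqxx.
have yW : y \in Vn n by apply: (fsubsetP xyVn); rewrite !inE eqxx orbT.
have [f fP fxy] := line_unit_potential conn xy (connVn n) xW yW.
by rewrite (eff_res_drop xW yW fP).
Unshelve. all: by end_near. Qed.

End Line.

Lemma free_eff_res_of_line (R : realType) (V : pointedType) (G : graph R V)
    (P : V -> probability (path_space V) R) x y :
  (forall x : V, random_walk_law G x (P x)) -> connected_graph G ->
  subgraph_of_line G -> x <> y ->
  free_eff_res G x y = (wsum G x (hit_prob P [set x] y))^-1.
Proof.
move=> P_law conn [phi [phi_inj phi_adj]] xy.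
have [lt_xy|] := ltP (phi x) (phi y); first exact: (line_free_eff_res P_law phi_inj).
rewrite le_eqVlt => /predU1P[/phi_inj/esym//|lt_yx].
apply: (@line_free_eff_res _ _ _ _ P_law (fun v => - phi v)) => //.
- by move=> u v /oppr_inj/phi_inj.
- by move=> u v /phi_adj; rewrite -opprD normrN.
- by rewrite ltrN2.
Qed.

(** * The identity forces separation *)

Section Converse.
Variables (R : realType) (V : pointedType) (G : graph R V).
Variable P : V -> probability (path_space V) R.
Hypothesis P_law : forall x, random_walk_law G x (P x).
Implicit Types (u v w x y z a b d : V) (W : {fset V}) (g H : V -> R).

(** The last clause is Ohm's law: the total voltage is 1, so the current out of
    [x] is the inverse of the effective resistance. *)
Definition voltage W x y g :=
  [/\ g x = 0, g y = 1,
      forall v, v \in W -> v <> x -> v <> y ->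
        \sum_(w <- W) G v w * g w = g v * \sum_(w <- W) G v w
    & \sum_(w <- W) G x w * g w = (eff_res G W x y)^-1].

(** A unit potential, normalised and turned upside down.  It is set to 0 outside
    [W] so that it has values in [0, 1] everywhere. *)
Lemma voltage_exists W x y : connected_on G [set` W] -> x \in W -> y \in W ->
  x != y -> eff_res G W x y != 0 ->
  exists g, [/\ unit_valued g, voltage W x y g & voltage W y x (fun v => 1 - g v)].
Proof.
move=> conn xW yW xy R0; have [f fP] := eff_res_neq0 R0.
have fN := unit_potentialN fP.
rewrite (eff_res_drop xW yW fP) in R0.
have fmax v : v \in W -> f v <= f x by move=> vW; exact: unit_potential_max fP.
have fmin v : v \in W -> f y <= f v.
  by move=> vW; rewrite -lerN2; exact: (unit_potential_max conn yW vW fN).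
have D0 : 0 < f x - f y by rewrite lt_def R0 subr_ge0 fmin.
have eff_xy := eff_res_drop xW yW fP.
have eff_yx : eff_res G W y x = f x - f y by rewrite (eff_res_drop yW xW fN); ring.
pose g v := if v \in W then (f x - f v) / (f x - f y) else 0.
have gE v : v \in W -> g v = (f x - f v) / (f x - f y) by rewrite /g => ->.
have gx : g x = 0 by rewrite gE// subrr mul0r.
have gy : g y = 1 by rewrite gE// divff.
have drop v : v \in W -> \sum_(w <- W) G v w * (g v - g w) =
    - ((v == x)%:R - (v == y)%:R) / (f x - f y).
  move=> vW; rewrite -fP// -sumrN mulr_suml; apply: eq_big_seq => w wW.
  by rewrite !gE//; field.
have sumg v : \sum_(w <- W) G v w * g w =
    g v * (\sum_(w <- W) G v w) - \sum_(w <- W) G v w * (g v - g w).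
  by rewrite mulr_sumr -sumrB; apply: eq_bigr => w _; ring.
have sumg' v : \sum_(w <- W) G v w * (1 - g w) =
    (1 - g v) * (\sum_(w <- W) G v w) + \sum_(w <- W) G v w * (g v - g w).
  by rewrite mulr_sumr -big_split; apply: eq_bigr => w _ /=; ring.
exists g; split.
- move=> v; rewrite /g; case: ifP => [vW|_]; last by rewrite lexx ler01.
  rewrite divr_ge0 ?(ltW D0) ?subr_ge0 ?fmax//= ler_pdivrMr// mul1r.
  by rewrite lerD2l lerN2 fmin.
- split=> // [v vW /eqP vx /eqP vy|].
    by rewrite sumg drop// (negPf vx) (negPf vy) subrr oppr0 mul0r subr0.
  rewrite sumg gx mul0r -[X in _ - X](_ : - (f x - f y)^-1 = _) ?eff_xy ?sub0r ?opprK//.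
  by have := drop x xW; rewrite gx eqxx (negPf xy) subr0 mulN1r.
- split=> [|| v vW /eqP vy /eqP vx|]; rewrite ?gx ?gy ?subrr ?subr0//.
    by rewrite sumg' drop// (negPf vx) (negPf vy) subrr oppr0 mul0r addr0.
  rewrite sumg' gy subrr mul0r add0r eff_yx.
  have := drop y yW; rewrite gy eqxx eq_sym (negPf xy) sub0r opprK div1r => <-.
  by [].
Qed.

(** Limits along an ultrafilter avoid the choice of a subsequence that converges
    at all vertices simultaneously. *)
Lemma ultrafilter_cvg (U : set_system nat) (u : nat -> R) : UltraFilter U ->
  (forall n, 0 <= u n <= 1) -> exists2 l : R, 0 <= l <= 1 & u n @[n --> U] --> l.
Proof.
move=> UU u01; have UP : ProperFilter U := @ultra_proper _ _ UU.
have [l []] := @segment_compact R 0 1 (u @ U) _ (filterE _ u01).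
rewrite /= in_itv /= => l01 cl; exists l => // N lN.
have [//|UN] := in_ultra_setVsetC (u @^-1` N) UU.
by have [r [/= Nr]] := cl (~` N) N UN lN.
Qed.

(** The limit voltage [H] dominates the hitting probability [h], the least
    solution, while its current out of [x] is at most that of [h].  So [H] and
    [h] agree at the neighbours of [x].  Wherever they agree off [y], the average
    of [H] is at most that of [h], and they agree at the neighbours too. *)
Lemma voltage_limit (U : set_system nat) Vn x y (g : nat -> V -> R) H :
  ProperFilter U -> \oo `<=` U -> exhaustion G Vn -> x <> y ->
  (forall n, unit_valued (g n)) -> unit_valued H ->
  (forall v, g n v @[n --> U] --> H v) ->
  (\forall n \near U, voltage (Vn n) x y (g n)) ->
  (eff_res G (Vn n) x y)^-1 @[n --> \oo] --> wsum G x (hit_prob P [set x] y) ->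
  forall v, joined G (~` [set y]) x v -> H v = hit_prob P [set x] y v.
Proof.
move=> UP oU exVn xy g01 H01 gH gV effL; set h := hit_prob P [set x] y.
have inVn W : \forall n \near U, (W `<=` Vn n)%fset.
  by apply: oU; exact: (exhaustion_near _ exVn).
have yx := nesym xy.
have h01 : unit_valued h := hit_prob_unit G P [set x] y.
have Hx : H x = 0.
  suff cst : g n x @[n --> U] --> (0 : R) by exact: (cvg_unique _ (gH x) cst).
  by apply: cvg_near_cst; apply: filterS gV => n [].
have Hy : H y = 1.
  suff cst : g n y @[n --> U] --> (1 : R) by exact: (cvg_unique _ (gH y) cst).
  by apply: cvg_near_cst; apply: filterS gV => n [].
have cvg_sum W v : \sum_(w <- W) G v w * g n w @[n --> U] --> \sum_(w <- W) G v w * H w.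
  elim: (enum_fset W) => [|w s IH].
    by rewrite big_nil; under eq_fun do rewrite big_nil; exact: cvg_cst.
  rewrite big_cons; under eq_fun do rewrite big_cons.
  by apply: cvgD IH; apply: cvgMl_tmp; exact: gH.
have sum_le n W v : (W `<=` Vn n)%fset ->
    \sum_(w <- W) G v w * g n w <= \sum_(w <- Vn n) G v w * g n w.
  apply: sum_fset_le => w; have /andP[gw _] := g01 n w.
  by rewrite mulr_ge0 ?weight_ge0.
(* Fatou: compare the sum over a finite [W] with that over the larger [Vn n]. *)
have supH v : v <> y -> v <> x -> superharmonic_at G H v.
  move=> vy vx; apply: wsum_le => // W.
  have gHv : vertex_weight G v * g n v @[n --> U] --> vertex_weight G v * H v.
    by apply: cvgMl_tmp; exact: gH.
  apply: (ler_cvg_to (cvg_sum W v) gHv).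
  have WV : \forall n \near U, ((v |` W)%fset `<=` Vn n)%fset := inVn _.
  apply: filterS2 WV gV => n WVn [_ _ harm _].
  have vn : v \in Vn n by apply: (fsubsetP WVn); rewrite !inE eqxx.
  apply: le_trans (sum_le n W v _) _; first exact: fsubset_trans (fsubsetUr _ _) WVn.
  rewrite harm// mulrC; have /andP[gv _] := g01 n v; apply: ler_wpM2r => //.
  rewrite -wsum1; apply: le_trans (wsum_ge G v (Vn n) (@unit_valued1 R V)).
  by apply: ler_sum => w _; rewrite mulr1.
have flux_le : wsum G x H <= wsum G x h.
  apply: wsum_le => // W.
  have effU : (eff_res G (Vn n) x y)^-1 @[n --> U] --> wsum G x h.
    by move=> A /effL /oU.
  apply: (ler_cvg_to (cvg_sum W x) effU).
  have WV : \forall n \near U, (W `<=` Vn n)%fset := inVn _.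
  by apply: filterS2 WV gV => n WVn [_ _ _ <-]; exact: sum_le.
have hH v : h v <= H v.
  have := two_point_minimal P_law v H01 yx supH.
  by rewrite Hx Hy mul1r mul0r addr0.
move=> v; elim=> [_|u {}w xu Hu uw wy]; first by rewrite Hx [h x](hit_prob_avoided P_law).
have uy : u <> y := joined_end xu.
have wsum_u : wsum G u H <= wsum G u h.
  have [->//|/eqP ux] := eqVneq u x.
  apply: le_trans (supH u uy ux) _; rewrite Hu.
  by rewrite [wsum G u h](hit_prob_harmonic P_law).
have := le_trans (wsum_gap G u w h01 H01 hH) wsum_u.
rewrite gerDl pmulr_rle0// subr_le0 => Hw.
by apply/le_anti; rewrite Hw hH.
Qed.

(** The voltage from [y] to [x] is 1 minus the voltage from [x] to [y], also in
    the limit; each limit is a hitting probability on its own side. *)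
Lemma recurrent_between x y v : connected_graph G ->
  (forall x y, x <> y ->
     free_eff_res G x y = (wsum G x (hit_prob P [set x] y))^-1) ->
  x <> y -> joined G (~` [set y]) x v -> joined G (~` [set x]) y v ->
  hit_prob P [set x] y v + hit_prob P [set y] x v = 1.
Proof.
move=> conn eqRF xy xv yv; have [Vn exVn] := exhaustion_exists conn.
have flux_gt0 a b : a <> b -> 0 < wsum G a (hit_prob P [set a] b).
  exact: (escape_gt0 P_law conn).
have eff_cvg a b : a <> b ->
    eff_res G (Vn n) a b @[n --> \oo] --> (wsum G a (hit_prob P [set a] b))^-1.
  move=> ab; rewrite -eqRF//; apply: free_eff_res_cvg => //.
  by rewrite eqRF// invr_eq0 gt_eqF// flux_gt0.
have effV_cvg a b : a <> b ->
    (eff_res G (Vn n) a b)^-1 @[n --> \oo] --> wsum G a (hit_prob P [set a] b).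
  move=> ab; rewrite -[X in _ --> X]invrK; apply: cvgV; last exact: eff_cvg.
  by rewrite invr_eq0 gt_eqF// flux_gt0.
pose good n := [/\ x \in Vn n, y \in Vn n & eff_res G (Vn n) x y != 0].
have /choice[g Hg] n : exists g, unit_valued g /\ (good n ->
    voltage (Vn n) x y g /\ voltage (Vn n) y x (fun v => 1 - g v)).
  have [[xn yn R0]|bad] := pselect (good n); last first.
    by exists (fun=> 1); split=> //; exact: unit_valued1.
  have [_ _ connVn] := exVn; have xy' : x != y by apply/eqP.
  by have [g [g01 gxy gyx]] := voltage_exists (connVn n) xn yn xy' R0; exists g.
have [U [UU oU]] := @ultraFilterLemma _ \oo _.
have UP : ProperFilter U := @ultra_proper _ _ UU.
have /choice[H HH] w : exists l : R, 0 <= l <= 1 /\ g n w @[n --> U] --> l.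
  by have [|l l01 gl] := ultrafilter_cvg UU (u := fun n => g n w);
    [move=> n; have [] := Hg n|exists l].
have H01 : unit_valued H by move=> w; have [] := HH w.
have goodU : \forall n \near U, good n.
  have xyV := oU _ (exhaustion_near [fset x; y]%fset exVn).
  have R0 : \forall n \near U, eff_res G (Vn n) x y != 0.
    apply: oU; apply: (cvgr_neq0 _ (eff_cvg _ _ xy)).
    by rewrite invr_eq0 gt_eqF// flux_gt0.
  apply: filterS2 R0 xyV => n Rn xyn; split=> //; apply: (fsubsetP xyn).
    by rewrite !inE eqxx.
  by rewrite !inE eqxx orbT.
have -> : hit_prob P [set x] y v = H v.
  apply/esym/(voltage_limit UP oU exVn xy (g := g)) => //.
  - by move=> n; have [] := Hg n.
  - by move=> w; have [] := HH w.
  - by apply: filterS goodU => n /(Hg n).2[].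
  - exact: effV_cvg.
have -> : hit_prob P [set y] x v = 1 - H v; last by rewrite addrC subrK.
have sub01 (s : V -> R) : unit_valued s -> unit_valued (fun w => 1 - s w).
  by move=> s01 w; have /andP[s0 s1] := s01 w; rewrite subr_ge0 s1 gerBl s0.
apply/esym/(voltage_limit UP oU exVn (nesym xy) (g := fun n w => 1 - g n w)
  (H := fun w => 1 - H w)) => //.
- by move=> n; apply: sub01; have [] := Hg n.
- exact: sub01.
- by move=> w; apply: cvgB; [exact: cvg_cst|have [] := HH w].
- by apply: filterS goodU => n /(Hg n).2[].
- exact: effV_cvg (nesym xy).
Qed.

(** With [f v = P_v(tau_d < oo)], optional stopping gives
    [f a >= p f b + (1 - p)] and [f b >= q f a + (1 - q)] with [p, q < 1], whence
    [f a = f b = 1].  A neighbour of [d] other than [a] and [b] is joined to both,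
    so the walk from it hits [{a, b}] almost surely and [f] is 1 there.  Thus the
    return probability of [d] is 1. *)
Lemma separation_of_free_eff_res a b d : connected_graph G -> transient P ->
  (forall x y, x <> y ->
     free_eff_res G x y = (wsum G x (hit_prob P [set x] y))^-1) ->
  a <> b -> b <> d -> a <> d ->
  joined G (~` [set a]) b d -> joined G (~` [set b]) a d ->
  joined G (~` [set d]) a b -> False.
Proof.
move=> conn trans eqRF ab bd ad bd_a ad_b ab_d.
pose f := hit_prob P set0 d.
have f01 : unit_valued f := hit_prob_unit G P set0 d.
have fd : f d = 1 by apply: (hit_prob_target P_law).
have supf v : superharmonic_at G f v.
  have [->|/eqP vd] := eqVneq v d.
    by rewrite /superharmonic_at fd mulr1 ltW// (return_probability_lt1 P_law).
  by rewrite /superharmonic_at [wsum G v f](hit_prob_harmonic P_law).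
have between x y v : x <> y -> joined G (~` [set y]) x v -> joined G (~` [set x]) y v ->
    f y * hit_prob P [set x] y v + f x * (1 - hit_prob P [set x] y v) <= f v.
  move=> xy xv yv; have rec := recurrent_between conn eqRF xy xv yv.
  rewrite (_ : 1 - _ = hit_prob P [set y] x v); last by rewrite -rec addrC addKr.
  by apply: (two_point_minimal P_law) => //; exact: nesym.
have fa := between b d a bd (joined_sym ab_d) (joined_sym ad_b).
have fb := between a d b ad ab_d (joined_sym bd_a).
have ad_gt0 : 0 < hit_prob P [set b] d a by apply: hit_prob_gt0.
have bd_gt0 : 0 < hit_prob P [set a] d b by apply: hit_prob_gt0.
have /andP[_ fa1] := f01 a; have /andP[_ fb1] := f01 b.
have /andP[_ p1] := hit_prob_unit G P [set b] d a.
have /andP[_ q1] := hit_prob_unit G P [set a] d b.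
rewrite fd in fa fb.
have fa_eq : f a = 1 by nra.
have fb_eq : f b = 1 by nra.
have := return_probability_lt1 P_law d trans; rewrite -/f -wsum1.
rewrite (eq_wsum (t := fun=> 1)) ?ltxx// => v dv.
have [->//|/eqP va] := eqVneq v a; have [->//|/eqP vb] := eqVneq v b.
apply/le_anti; have /andP[_ ->] := f01 v.
have := between a b v ab (joined_step ad_b dv vb) (joined_step bd_a dv va).
by rewrite fa_eq fb_eq !mul1r addrC subrK.
Qed.

End Converse.

Theorem corollary6p3 (R : realType) (V : pointedType) (G : graph R V)
    (P : V -> probability (path_space V) R)
    (P_law : forall x : V, random_walk_law G x (P x))
    (G_transient : transient P)
    (G_connected : connected_graph G) :
  (forall x y : V, x <> y ->
     free_eff_res G x y = 1 / (vertex_weight G x * escape_probability P x y))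
  <-> subgraph_of_line G.
Proof.
split=> [eqRF|line x y xy].
  have eqRF' x y : x <> y ->
      free_eff_res G x y = (wsum G x (hit_prob P [set x] y))^-1.
    by move=> xy; rewrite eqRF// (escape_probabilityE P_law)// div1r.
  apply: line_of_separation => // a b d.
  exact: (separation_of_free_eff_res P_law).
rewrite (escape_probabilityE P_law)// div1r.
exact: (free_eff_res_of_line P_law).
Qed.
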